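(* There is a function $g:\mathbb{N}\to\mathbb{R}$ with $g(n)/n^2\to 0$ as $n\to\infty$ such that the following holds. Let $G$ be a triangle-free graph on $n$ vertices, where $n$ is divisible by $3$. Then there exists a partition $V(G)=A_1\cup A_2\cup A_3$ with $|A_1|=|A_2|=|A_3|=n/3$ such that $e(A_i)\leq n^2/48+g(n)$ for each $i\in\{1,2,3\}$.
   Context: For $S\subseteq V(G)$, $e(S)$ denotes the number of edges of $G$ with both endpoints in $S$. *)

(* Defs.v *)
From mathcomp Require Import all_boot all_order all_algebra.
From mathcomp Require Import all_classical all_reals all_analysis.

Set Implicit Arguments.
Unset Strict Implicit.
Unset Printing Implicit Defensive.

Definition triangle_free (T : finType) (E : rel T) : Prop :=
  forall x y z : T, ~~ [&& E x y, E y z & E x z].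

(* Edges are unordered pairs, so each one is counted once. *)
Definition edge_set (T : finType) (E : rel T) : {set {set T}} :=
  [set [set p.1; p.2]%SET | p : T * T & E p.1 p.2]%SET.

Definition num_edges_in (T : finType) (E : rel T) (S : {set T}) : nat :=
  #|[set e in edge_set E | e \subset S]%SET|.

(* An indexed family, so that empty parts are allowed (needed when #|T| = 0). *)
Definition is_partition (T : finType) (k : nat) (A : 'I_k -> {set T}) : Prop :=
  (\bigcup_(i < k) A i)%SET = [set: T]%SET /\
  forall i j : 'I_k, i != j -> [disjoint A i & A j].

(* Main.v *)
Require Import Defs.
From mathcomp Require Import all_boot all_order all_algebra.
From mathcomp Require Import ring lra zify.
Import Order.TTheory GRing.Theory Num.Theory.
Local Open Scope ring_scope.

(* Edges are counted up to lower-order terms, with al n^2 the number of edges of G. It is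
   enough to find A of size n/3 with at most n^2/48 edges inside and at most n^2/12 edges in
   its complement, since the complement can then be halved with a quarter of its edges
   on each side. A random half or third with balanced degree sum behaves as expected
   on both sides, because e(A) - e(X \ A) is determined by the degree sum of A.

   If al <= 3/16, a random third works. Otherwise let N(x) be the neighbourhood of x, d its
   size and S the number of edges leaving it.
   - If some d >= 2n/3, take for A the complement of N(x) and the vertices of smallest degree
     of N(x); a maximal matching outside N(x) bounds the edges not meeting N(x).
   - If all d < 2n/3, then sum S = sum d^2 over the vertices gives, for every la, a vertex x
     with S >= d^2 + la (2 al n - d) n. For a suitable la, either d >= n/3 and the n/3
     vertices of largest degree in N(x) form A, or d < n/3 and A is N(x) with a random
     set of n/3 - d other vertices. *)

(** * Averaging and selection in a finite set *)

Lemma exists_le_average (R : realFieldType) (T : finType) (A : {set T}) (h : T -> R) :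
  A != set0 -> exists2 x, x \in A & #|A|%:R * h x <= \sum_(y in A) h y.
Proof.
case/set0Pn=> x0 x0A; case: (@arg_minP _ _ T x0 (mem A) h x0A) => x xA minx.
exists x => //; rewrite mulr_natl -sumr_const; exact: ler_sum.
Qed.

Lemma exists_top_set (R : realFieldType) (T : finType) (X : {set T}) (f : T -> R) k :
  (k <= #|X|)%N -> exists G : {set T}, [/\ G \subset X, #|G| = k &
    forall x y, x \in G -> y \in X :\: G -> f y <= f x].
Proof.
elim: k => [|k IHk] kX.
  by exists set0; rewrite sub0set cards0; split=> // x y; rewrite inE.
have [G [GX cG topG]] := IHk (ltnW kX).
have /set0Pn[z0 z0X] : X :\: G != set0.
  by rewrite -card_gt0 cardsDS // cG subn_gt0.
case: (@arg_maxP _ _ T z0 (mem (X :\: G)) f z0X) => z /= zX maxz.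
have [zG zX'] := setDP zX.
exists (z |: G); split; first by rewrite subUset sub1set zG.
  by rewrite cardsU1 zX' cG.
move=> x y; rewrite !inE => /orP[/eqP-> |xG] /andP[]; rewrite negb_or => /andP[_ yG] yX.
  have yXG : y \in X :\: G by rewrite inE yG.
  exact: maxz.
by apply: topG; rewrite // inE yG.
Qed.

(** * Edge counts as sums over ordered pairs *)

Lemma sum_setU_disjoint (V : nmodType) (T : finType) (A B : {set T}) (F : T -> V) :
  [disjoint A & B] ->
  \sum_(x in A :|: B) F x = \sum_(x in A) F x + \sum_(x in B) F x.
Proof.
by move=> dAB; rewrite -bigU //; apply: eq_bigl => x; rewrite !inE.
Qed.

(* Ordered pairs are counted, so edge_sum A A is twice the number of edges inside A. *)
Definition edge_sum {R : realFieldType} {T : finType} (E : rel T) (A B : {set T}) : R :=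
  \sum_(x in A) \sum_(y in B) (E x y)%:R.

Lemma edge_sum_ge0 (R : realFieldType) (T : finType) (E : rel T) (A B : {set T}) :
  0 <= edge_sum E A B :> R.
Proof. by apply: sumr_ge0 => x _; apply: sumr_ge0. Qed.

Lemma edge_sumC (R : realFieldType) (T : finType) (E : rel T) (A B : {set T}) :
  symmetric E -> edge_sum E A B = edge_sum E B A :> R.
Proof.
move=> sE; rewrite /edge_sum exchange_big; apply: eq_bigr => x _.
by apply: eq_bigr => y _; rewrite sE.
Qed.

Lemma edge_sumUl (R : realFieldType) (T : finType) (E : rel T) (A B C : {set T}) :
  [disjoint A & B] -> edge_sum E (A :|: B) C = edge_sum E A C + edge_sum E B C :> R.
Proof. by move=> dAB; rewrite /edge_sum sum_setU_disjoint. Qed.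

Lemma edge_sumUr (R : realFieldType) (T : finType) (E : rel T) (A B C : {set T}) :
  symmetric E -> [disjoint A & B] ->
  edge_sum E C (A :|: B) = edge_sum E C A + edge_sum E C B :> R.
Proof. by move=> sE dAB; rewrite !(edge_sumC _ _ _ C) // edge_sumUl. Qed.

Lemma edge_sumU (R : realFieldType) (T : finType) (E : rel T) (A B : {set T}) :
  symmetric E -> [disjoint A & B] ->
  edge_sum E (A :|: B) (A :|: B) =
  edge_sum E A A + 2 * edge_sum E A B + edge_sum E B B :> R.
Proof.
move=> sE dAB; rewrite edge_sumUl // !edge_sumUr // (edge_sumC _ _ _ B A) //.
by ring.
Qed.

Lemma edge_sumS (R : realFieldType) (T : finType) (E : rel T) (A B C D : {set T}) :
  A \subset C -> B \subset D -> edge_sum E A B <= edge_sum E C D :> R.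
Proof.
move=> sAC sBD; rewrite /edge_sum [leRHS](big_setID A) (setIidPr sAC) /=.
rewrite -[leLHS]addr0; apply: lerD; last exact: (edge_sum_ge0 _ _ E (C :\: A) D).
apply: ler_sum => x _; rewrite [leRHS](big_setID B) (setIidPr sBD) /=.
by rewrite lerDl sumr_ge0.
Qed.

Lemma edge_sum1l (R : realFieldType) (T : finType) (E : rel T) x (B : {set T}) :
  edge_sum E [set x] B = \sum_(y in B) (E x y)%:R :> R.
Proof. by rewrite /edge_sum big_set1. Qed.

Lemma edge_sum11 (R : realFieldType) (T : finType) (E : rel T) x :
  irreflexive E -> edge_sum E [set x] [set x] = 0 :> R.
Proof. by move=> iE; rewrite edge_sum1l big_set1 iE. Qed.

Lemma edge_sum_indep (R : realFieldType) (T : finType) (E : rel T) (A : {set T}) :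
  {in A &, forall x y, ~~ E x y} -> edge_sum E A A = 0 :> R.
Proof.
by move=> iA; apply: big1 => x xA; apply: big1 => y yA; rewrite (negPf (iA _ _ xA yA)).
Qed.

Lemma edge_sum_setU1 (R : realFieldType) (T : finType) (E : rel T) x (A : {set T}) :
  symmetric E -> irreflexive E -> x \notin A ->
  edge_sum E (x |: A) (x |: A) = edge_sum E A A + 2 * \sum_(y in A) (E x y)%:R :> R.
Proof.
move=> sE iE xA; rewrite edge_sumU ?disjoints1 // edge_sum11 // edge_sum1l.
by rewrite add0r addrC.
Qed.

(** Every edge [{a, b}] comes from the ordered pairs [(a, b)] and [(b, a)], distinct because there
    are no loops. *)
Lemma num_edges_in_le (R : realFieldType) (T : finType) (E : rel T) (S : {set T}) :
  symmetric E -> irreflexive E ->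
  (num_edges_in E S)%:R <= edge_sum E S S / 2 :> R.
Proof.
move=> sE iE; rewrite ler_pdivlMr //.
pose P := [set p : T * T | [&& p.1 \in S, p.2 \in S & E p.1 p.2]].
have -> : edge_sum E S S = #|P|%:R :> R.
  rewrite /edge_sum pair_big_dep /= -sum1_card natr_sum.
  rewrite (eq_bigr (fun p => if E p.1 p.2 then 1 else 0)); last first.
    by move=> p _; case: (E _ _).
  by rewrite -big_mkcondr; apply: eq_bigl => p; rewrite inE andbA.
rewrite -natrM ler_nat /num_edges_in; set F := [set e in _ | _].
pose f (p : T * T) := [set p.1; p.2].
rewrite -[leqRHS]sum1_card (partition_big f (mem F)) /=; last first.
  move=> p; rewrite !inE => /and3P[p1 p2 Ep]; rewrite /edge_set subUset !sub1set p1 p2.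
  by rewrite !andbT; apply/imsetP; exists p; rewrite ?inE.
rewrite -sum_nat_const; apply: leq_sum => e.
rewrite inE /edge_set => /andP[/imsetP[[a b]]]; rewrite inE /= => Eab ->.
rewrite subUset !sub1set => /andP[aS bS].
have ab : (a, b) != (b, a).
  by apply: contraTneq Eab => -[-> _]; rewrite iE.
rewrite sum1dep_card -[X in (X <= _)%N](_ : #|[set (a, b); (b, a)]| = _); last by rewrite cards2 ab.
apply: subset_leq_card; apply/subsetP => p; rewrite !inE => /orP[]/eqP -> /=.
  by rewrite aS bS Eab eqxx.
by rewrite aS bS sE Eab /f /= setUC eqxx.
Qed.

(** * Subsets with few edges, by averaging *)

(* A is found by averaging over all transversals of a partition of X into blocks of
   consecutive elements in decreasing order of f; the telescoping of f along the
   blocks controls the f-sum of every transversal. The linear cost c is there for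
   the induction, where it carries the edges to the vertices already chosen. *)
Lemma balanced_transversal (R : realFieldType) (T : finType) (E : rel T) (f : T -> R) (k m : nat) :
  symmetric E -> irreflexive E -> (0 < k)%N -> (forall x, 0 <= f x) ->
  forall (X : {set T}) (c : T -> R) (hi : R),
  #|X| = (k * m)%N -> 0 <= hi -> {in X, forall x, f x <= hi} ->
  exists A : {set T}, [/\ A \subset X, #|A| = m,
    k%:R ^+ 2 * (edge_sum E A A + \sum_(x in A) c x) <=
      edge_sum E X X + k%:R * \sum_(x in X) c x &
    \sum_(x in X) f x <= k%:R * (hi + \sum_(x in A) f x)].
Proof.
move=> sE iE k0 f0; have kR0 : 0 < k%:R :> R by rewrite ltr0n.
elim: m => [|m IHm] X c hi cX hi0 fX.
  have /eqP -> : X == set0 by rewrite -cards_eq0 cX muln0.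
  exists set0; rewrite sub0set cards0 /edge_sum !big_set0 !addr0 !mulr0 addr0; split=> //.
  by rewrite mulr_ge0 // ltW.
have [|G [GX cG topG]] := @exists_top_set R T X f k; first by rewrite cX mulnS leq_addr.
pose Y := X :\: G.
have XE : X = G :|: Y by rewrite -{1}(setID X G) (setIidPr GX).
have dGY : [disjoint G & Y] by rewrite disjoints_subset; apply/subsetP=> x; rewrite !inE => ->.
have cY : #|Y| = (k * m)%N by rewrite cardsDS // cX cG mulnS addKn.
have G0 : G != set0 by rewrite -card_gt0 cG.
have [x xG] := @exists_le_average R T G (fun x => 2 * \sum_(y in Y) (E x y)%:R + k%:R * c x) G0.
rewrite cG big_split /= -!mulr_sumr -/(edge_sum E G Y) => avg.
(* The bound [f x] holds on all lower blocks, so each block is charged to the element chosen in the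
   block above it. The edges from [x] move into the cost. *)
have [||A [AY cA wA sA]] := IHm Y (fun y => c y + 2 * (E x y)%:R) (f x) cY.
- exact: f0.
- by move=> y yY; apply: topG.
have xA : x \notin A.
  by apply/negP => /(subsetP AY); rewrite inE xG.
exists (x |: A); split.
- by rewrite XE setUSS // sub1set.
- by rewrite cardsU1 xA cA.
- rewrite edge_sum_setU1 // big_setU1 //=.
  rewrite {3}XE sum_setU_disjoint //= XE edge_sumU //.
  move: wA; rewrite !big_split /= -!mulr_sumr.
  have := edge_sum_ge0 R T E G G.
  set a := \sum_(_ in A) _; set b := \sum_(_ in Y) (E x _)%:R in avg *.
  nra.
- rewrite big_setU1 //= {1}XE sum_setU_disjoint //=.
  have : \sum_(y in G) f y <= k%:R * hi.
    rewrite mulr_natl -cG -sumr_const; apply: ler_sum => y yG.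
    by apply: fX; rewrite XE inE yG.
  lra.
Qed.

(** With [f] the degree inside [X], balance gives [e(A,X) >= e(X,X)/k - |X|]. For [B = X \ A] it
    remains to use [e(B,B) = e(X,X) - 2 e(A,X) + e(A,A)]. *)
Lemma balanced_split (R : realFieldType) (T : finType) (E : rel T) (X : {set T}) (k m : nat) :
  symmetric E -> irreflexive E -> (0 < k)%N -> #|X| = (k * m)%N ->
  exists A : {set T}, [/\ A \subset X, #|A| = m,
    edge_sum E A A <= k%:R ^- 2 * edge_sum E X X :> R &
    edge_sum E (X :\: A) (X :\: A) <= (1 - k%:R^-1) ^+ 2 * edge_sum E X X + 2 * #|X|%:R :> R].
Proof.
move=> sE iE k0 cX.
have kR0 : 0 < k%:R :> R by rewrite ltr0n.
have [|||A [sAX cA wA sA]] := @balanced_transversal R T E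
  (fun x => \sum_(y in X) (E x y)%:R) k m sE iE k0 _ X (fun=> 0) #|X|%:R cX.
- by move=> x; apply: sumr_ge0.
- by [].
- move=> x _; rewrite -sum1_card natr_sum; apply: ler_sum => y _.
  by rewrite ler_nat leq_b1.
move: wA; rewrite !big1 // mulr0 !addr0 => wA.
have wA' : edge_sum E A A <= k%:R ^- 2 * edge_sum E X X :> R.
  by rewrite mulrC ler_pdivlMr ?exprn_gt0 // mulrC.
exists A; split=> //.
pose B := X :\: A.
have dAB : [disjoint A & B].
  by rewrite disjoints_subset; apply/subsetP=> x; rewrite !inE => ->.
have XE : X = A :|: B by rewrite -{1}(setID X A) (setIidPr sAX).
move: sA; rewrite -/(edge_sum E X X) -/(edge_sum E A X) -/B.
have -> : edge_sum E A X = edge_sum E A A + edge_sum E A B :> R.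
  by rewrite [in LHS]XE edge_sumUr.
have WE : edge_sum E X X = edge_sum E A A + 2 * edge_sum E A B + edge_sum E B B :> R.
  by rewrite [in LHS]XE edge_sumU.
move=> sA.
have {sA} : k%:R^-1 * edge_sum E X X <= #|X|%:R + (edge_sum E A A + edge_sum E A B) :> R.
  by rewrite mulrC ler_pdivrMr // mulrC.
move: wA'; rewrite -exprVn; set i := k%:R^-1; rewrite expr2; lra.
Qed.

(** Vertices are deleted one at a time, each chosen by averaging so that the right-hand side does
    not grow. The cost [c] serves to count edges to a fixed set. *)
Lemma sparse_subset (R : realFieldType) (T : finType) (E : rel T) (q : nat) :
  symmetric E -> irreflexive E ->
  forall (X : {set T}) (c : T -> R), (q <= #|X|)%N ->
  exists Z : {set T}, [/\ Z \subset X, #|Z| = q &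
    edge_sum E Z Z + \sum_(x in Z) c x <=
      (q%:R / #|X|%:R) ^+ 2 * edge_sum E X X + q%:R / #|X|%:R * \sum_(x in X) c x].
Proof.
move=> sE iE; have [-> X c _|q0 X c /subnKC] := posnP q.
  exists set0; rewrite sub0set cards0 mul0r expr0n /= !mul0r.
  by rewrite /edge_sum !big_set0 addr0.
have qR0 : 0 < q%:R :> R by rewrite ltr0n.
move: (#|X| - q)%N => m; elim: m X => [|m IHm] X cX.
  have {}cX : #|X| = q by rewrite -cX addn0.
  by exists X; split=> //; rewrite cX divff ?gt_eqF // expr1n !mul1r.
have cX0 : X != set0 by rewrite -card_gt0 -cX addnS.
pose b : R := q%:R / (q + m)%:R.
(* [h x] is the bound that the induction hypothesis gives once [x] is deleted. *)
pose h x : R := b ^+ 2 * (edge_sum E X X - 2 * \sum_(y in X) (E x y)%:R)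
  + b * (\sum_(y in X) c y - c x).
have [x xX] := exists_le_average _ _ _ h cX0.
rewrite /h big_split /= -!mulr_sumr !sumrB -mulr_sumr !sumr_const -/(edge_sum E X X).
have cN : #|X|%:R = (q + m)%:R + 1 :> R by rewrite -cX addnS natr1.
rewrite -[edge_sum E X X *+ _]mulr_natr -[(\sum_(y in X) c y) *+ _]mulr_natr cN => avg.
have cX' : #|X :\ x| = (q + m)%N.
  by apply/eqP; rewrite -eqSS -addnS cX (cardsD1 x X) xX.
have [Z [sZ cZ wZ]] := IHm (X :\ x) (esym cX').
exists Z; split=> //; first by apply: subset_trans sZ (subD1set _ _).
apply: le_trans wZ _.
have WE : edge_sum E X X = edge_sum E (X :\ x) (X :\ x)
   + 2 * \sum_(y in X) (E x y)%:R :> R.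
  rewrite -[in LHS](setD1K xX) edge_sum_setU1 ?setD11 //.
  by rewrite (big_setD1 x xX) /= iE add0r.
have W0 := edge_sum_ge0 R T E X X.
move: avg; rewrite cX' (big_setD1 x xX (F := c)) /=.
have n0 : 0 < (q + m)%:R :> R by rewrite ltr0n addn_gt0 q0.
rewrite /b; clear h b; set n := (q + m)%:R in n0 *.
move: WE W0.
set W := edge_sum E X X; set w := edge_sum _ _ _; set e := \sum_(y in X) _.
set C := \sum_(y in _) _; set t : R := q%:R / (n + 1); move=> WE W0.
have n10 : 0 < n + 1 by rewrite addr_gt0.
have -> : q%:R / n = t * (n + 1) / n by rewrite /t divfK ?gt_eqF.
set b := t * (n + 1) / n.
have bn : b * n = t * (n + 1) by rewrite /b divfK ?gt_eqF.
move=> avg; rewrite -(ler_pM2l n10).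
(* The quadratic part rests on [(n - 1)(n + 1) <= n^2]. *)
have : (n - 1) * b ^+ 2 * W <= (n + 1) * t ^+ 2 * W.
  rewrite ler_wpM2r // -(ler_pM2l n10).
  have -> : (n + 1) * ((n + 1) * t ^+ 2) = (b * n) ^+ 2 by rewrite bn; ring.
  by have := sqr_ge0 b; lra.
have : b * n * (c x + C) = t * (n + 1) * (c x + C) by rewrite bn.
move: avg; rewrite WE; lra.
Qed.

(** * Maximal matchings and independent sets *)

(* nu is the number of edges of a maximal matching in X. *)
Lemma matching_bound (R : realFieldType) (T : finType) (E : rel T) (f : T -> R) (a : R) :
  symmetric E -> irreflexive E -> triangle_free E ->
  forall X : {set T}, {in X, forall x, f x <= a} ->
  {in X &, forall x y, E x y -> f x + f y <= a} ->
  exists nu : R, [/\ 0 <= nu, 2 * nu <= #|X|%:R,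
    \sum_(x in X) f x <= (#|X|%:R - nu) * a &
    edge_sum E X X <= 2 * nu * (#|X|%:R - nu)].
Proof.
move=> sE iE tfE X; have [n] := ubnP #|X|; elim: n X => // n IHn X cX fX fE.
have [/existsP[[p q] /and3P[/= pX qX Epq]]|] :=
    boolP [exists z : T * T, [&& z.1 \in X, z.2 \in X & E z.1 z.2]]; last first.
  move=> /existsPn noE; exists 0; rewrite mulr0 mul0r subr0; split=> //.
    by rewrite mulr_natl -sumr_const; apply: ler_sum.
  rewrite edge_sum_indep // => x y xX yX.
  by have := noE (x, y); rewrite /= xX yX.
have pq : p != q by apply: contraTneq Epq => ->; rewrite iE.
pose Y := X :\ p :\ q.
have qXp : q \in X :\ p by rewrite !inE eq_sym pq.
have pY : p \notin q |: Y by rewrite setD1K // setD11.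
have qY : q \notin Y by rewrite setD11.
have XE : X = p |: (q |: Y) by rewrite !setD1K.
have cXY : #|X| = #|Y|.+2 by rewrite XE !cardsU1 pY qY.
have YX : Y \subset X by rewrite XE; apply: subset_trans (subsetUr _ _) (subsetUr _ _).
have [|x /(subsetP YX)|x y /(subsetP YX) xX /(subsetP YX)|nu [nu0 nuY fY eY]] := IHn Y.
- by rewrite -ltnS (leq_trans _ cX) // cXY.
- exact: fX.
- exact: fE.
have cR : #|X|%:R = #|Y|%:R + 2 :> R by rewrite cXY -addn2 natrD.
exists (nu + 1); rewrite cR; split.
- by rewrite addr_ge0.
- by lra.
- rewrite XE !big_setU1 //= addrA; have := fE p q pX qX Epq; lra.
rewrite XE edge_sum_setU1 // edge_sum_setU1 // big_setU1 //=.
have -> : (E p q)%:R = 1 :> R by rewrite Epq.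
(* Without triangles, each [y] is adjacent to at most one end of the matching edge. *)
have : \sum_(y in Y) (E q y)%:R + \sum_(y in Y) (E p y)%:R <= #|Y|%:R :> R.
  rewrite -big_split /= -sum1_card natr_sum; apply: ler_sum => y _.
  rewrite -natrD ler_nat; have := tfE p q y; rewrite Epq /=.
  by case: (E q y); case: (E p y).
lra.
Qed.

(** As [I] is independent, [Z] only adds its edges to the complement of [I], and it can be chosen to
    have at most its proportional share of them. *)
Lemma sparse_extension (R : realFieldType) (T : finType) (E : rel T) (I : {set T}) (q : nat) :
  symmetric E -> irreflexive E -> {in I &, forall x y, ~~ E x y} -> (q <= #|I|)%N ->
  exists Z : {set T}, [/\ Z \subset I, #|Z| = q &
    edge_sum E (Z :|: ~: I) (Z :|: ~: I) <=
      2 * (q%:R / #|I|%:R * edge_sum E I (~: I)) + edge_sum E (~: I) (~: I) :> R].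
Proof.
move=> sE iE indI qI.
have [Z [ZI cZ wZ]] := sparse_subset R T E q sE iE I
  (fun x => \sum_(y in ~: I) (E x y)%:R) qI.
exists Z; split=> //; rewrite edge_sumU //; last first.
  by rewrite disjoints_subset setCK.
move: wZ; rewrite -/(edge_sum E Z (~: I)) -/(edge_sum E I (~: I)).
rewrite (edge_sum_indep _ _ _ I) // mulr0 add0r.
rewrite (edge_sum_indep _ _ _ Z); first lra.
by move=> x y /(subsetP ZI) xI /(subsetP ZI); apply: indI.
Qed.

(** * Real inequalities behind the cases *)

(* The extremal case is a complete bipartite graph with parts n/4 and 3n/4, that is
   a + nu = 3/4 n. *)
Lemma matching_case_bound (R : realFieldType) (n a S e nu : R) :
  0 < n -> 2 * n <= 3 * a -> 0 <= nu -> a + nu <= n -> 3/8 * n ^+ 2 < 2 * S + 2 * e ->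
  S <= (n - a - nu) * a -> e <= nu * (n - a - nu) ->
  2 * ((a - 2/3 * n) / a * S) + 2 * e <= n ^+ 2 / 24.
Proof.
move=> n0 h1 h2 h3 h4 h5 h7.
have a0 : 0 < a by lra.
have ht : a + nu <= 3/4 * n.
  rewrite leNgt; apply/negP => ht.
  (* For [t = a + nu] the bounds on [S] and [e] add up to [3/16 n^2 < t (n - t)], so [t] lies
     between [n/4] and [3n/4]. *)
  have : 0 <= (a + nu - 3/4 * n) * (a + nu - 1/4 * n) by rewrite mulr_ge0 //; lra.
  lra.
rewrite -(ler_pM2l a0).
have -> : a * (2 * ((a - 2/3 * n) / a * S) + 2 * e) = 2 * ((a - 2/3 * n) * S + a * e).
  by field; rewrite gt_eqF.
(* This product is [a (n^2/48 - (n - t)(t - 2n/3))], the slack left when [S] and [e] equal their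
   bounds. *)
have : 0 <= a * ((3/4 * n - (a + nu)) * (11/12 * n - (a + nu))).
  by rewrite !mulr_ge0 //; lra.
have : 0 <= (a - 2/3 * n) * ((n - a - nu) * a - S) by rewrite mulr_ge0 ?subr_ge0 //; lra.
have : 0 <= a * (nu * (n - a - nu) - e) by rewrite mulr_ge0 ?subr_ge0 // ltW.
lra.
Qed.

(* The factor 31/8 is a compromise: [large_degree_bound] needs (k - 3)^2 + 8 k <= 32
   for k = 31/8, while [small_degree_bound_in] needs k as large as possible. *)
Definition slope {R : realFieldType} (al : R) : R := 1/2 + 31/8 * (1/4 - al).

(** The difference of the two bounds is a quadratic in [d] with nonpositive discriminant. The
    conclusion is what leaves at most [n^2/6] ordered pairs outside a third chosen in a
    neighbourhood of size [d]. *)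
Lemma large_degree_bound (R : realFieldType) (n al d S : R) :
  0 < n -> 3/16 <= al -> al <= 1/4 ->
  d ^+ 2 + slope al * (2 * al * n - d) * n <= S ->
  3 * (al - 1/12) * n * d <= S.
Proof.
move=> n0 h1 h2; apply: le_trans.
have hh : 0 <= (al - 3/16) * (1/4 - al) by rewrite mulr_ge0 // subr_ge0.
have h : (slope al + 3 * (al - 1/12)) ^+ 2 <= 8 * al * slope al by rewrite /slope; lra.
have := ler_wpM2r (sqr_ge0 n) h.
have := sqr_ge0 (d - (slope al + 3 * (al - 1/12)) / 2 * n).
move: (slope al) => la; lra.
Qed.

(** The lower bound on [S] is smallest at [d = slope al / 2 * n]. It limits the edges that avoid the
    neighbourhood. *)
Lemma small_degree_bound_out (R : realFieldType) (n al d S : R) :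
  0 < n -> 3/16 <= al -> al <= 1/4 ->
  d ^+ 2 + slope al * (2 * al * n - d) * n <= S ->
  2 * al * n ^+ 2 - 2 * S <= n ^+ 2 / 6.
Proof.
move=> n0 h1 h2 hS.
have hh : 0 <= (al - 3/16) * (1/4 - al) by rewrite mulr_ge0 // subr_ge0.
have h : al - 2 * al * slope al + slope al ^+ 2 / 4 <= 1/12 by rewrite /slope; lra.
have := ler_wpM2r (sqr_ge0 n) h.
have := sqr_ge0 (d - slope al / 2 * n).
move: (slope al) hS => la; lra.
Qed.

(** Here [n = 1], and [2/3 * d] bounds [S] when all degrees are below [2/3]. The conclusion is a
    linear function of [al] lying below the smaller root of the quadratic in [d]. *)
Lemma small_degree_lower_bound (R : realFieldType) (al d : R) :
  3/16 <= al -> al <= 1/4 -> 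
  d ^+ 2 + slope al * (2 * al - d) <= 2/3 * d ->
  47/200 + (al - 3/16)/2 <= d.
Proof.
move=> h1 h2; rewrite /slope => hS; rewrite leNgt; apply/negP => hd.
nra.
Qed.

(** Since [al <= 3/16 + 2 y], a cubic inequality in [y] alone remains. *)
Lemma small_degree_cubic_bound (R : realFieldType) (al d : R) :
  3/16 <= al -> al <= 1/4 -> d <= 1/3 ->
  47/200 + (al - 3/16)/2 <= d ->
  (1/3 - d) * (4/9 * d) + (1/3 - d) ^+ 2 * al <= (1 - d) ^+ 2 / 48.
Proof.
move=> h1 h2 h3 hd; set x := 1/3 - d; set y := d - 47/200.
have x0 : 0 <= x by rewrite subr_ge0.
have y0 : 0 <= y by rewrite /y; lra.
have : 0 <= x ^+ 2 * (3/16 + 2 * y - al).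
  by rewrite mulr_ge0 ?sqr_ge0 //= /y; lra.
have := mulr_ge0 y0 y0.
have := mulr_ge0 (mulr_ge0 y0 y0) x0.
rewrite /y /x; lra.
Qed.

(** The left side is what [sparse_subset] gives when [n/3 - d] of the [n - d] vertices outside a
    neighbourhood are added to it. Scaling by [n] and using [S <= 2/3 n d] reduces it to the cubic
    bound. *)
Lemma small_degree_bound_in (R : realFieldType) (n al d S : R) :
  0 < n -> 3/16 <= al -> al <= 1/4 -> d <= n / 3 -> 0 <= d ->
  d ^+ 2 + slope al * (2 * al * n - d) * n <= S -> S <= 2/3 * n * d ->
  ((n / 3 - d) / (n - d)) ^+ 2 * (2 * al * n ^+ 2 - 2 * S)
    + (n / 3 - d) / (n - d) * (2 * S) <= n ^+ 2 / 24.
Proof.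
move=> n0 h1 h2 d3 d0 hS Sd.
have nd : 0 < n - d by lra.
have [x dE] : exists x, d = x * n by exists (d / n); rewrite divfK // gt_eqF.
have n2 : 0 < n ^+ 2 by rewrite exprn_gt0.
have x3 : x <= 1/3 by rewrite -(ler_pM2r n0) -dE; lra.
have xge : 47/200 + (al - 3/16) / 2 <= x.
  apply: small_degree_lower_bound => //; rewrite -(ler_pM2r n2); move: hS Sd.
  rewrite dE; move: (slope al) => la; lra.
have := small_degree_cubic_bound _ _ _ h1 h2 x3 xge; rewrite -(ler_pM2r (exprn_gt0 4 n0)) => key.
have nd2 : 0 < (n - d) ^+ 2 by rewrite exprn_gt0.
rewrite -(ler_pM2l nd2).
have -> : (n - d) ^+ 2 * (((n / 3 - d) / (n - d)) ^+ 2 * (2 * al * n ^+ 2 - 2 * S)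
    + (n / 3 - d) / (n - d) * (2 * S)) =
  4/3 * n * ((n / 3 - d) * S) + 2 * ((n / 3 - d) ^+ 2 * al * n ^+ 2).
  by field; rewrite gt_eqF.
have : 0 <= n * ((n / 3 - d) * (2/3 * n * d - S)).
  by rewrite !mulr_ge0 ?subr_ge0 // ltW.
move: key; rewrite dE; lra.
Qed.

(** * Neighbourhoods and Mantel's theorem *)

Definition nbhd {T : finType} (E : rel T) (x : T) : {set T} := [set y | E x y].

Lemma nbhd_indep (T : finType) (E : rel T) x :
  symmetric E -> triangle_free E -> {in nbhd E x &, forall y z, ~~ E y z}.
Proof.
move=> sE tfE y z; rewrite !inE => xy xz.
by have := tfE x y z; rewrite xy xz andbT.
Qed.

Lemma sum_edge (R : realFieldType) (T : finType) (E : rel T) x (B : {set T}) :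
  \sum_(y in B) (E x y)%:R = #|B :&: nbhd E x|%:R :> R.
Proof.
rewrite -sum1_card natr_sum (eq_bigr (fun y => if E x y then 1 else 0)).
  by rewrite -big_mkcondr; apply: eq_bigl => y; rewrite !inE.
by move=> y _; case: (E x y).
Qed.

Lemma edge_sum_setT (R : realFieldType) (T : finType) (E : rel T) (A : {set T}) :
  edge_sum E A [set: T] = \sum_(x in A) #|nbhd E x|%:R :> R.
Proof. by apply: eq_bigr => x _; rewrite sum_edge setTI. Qed.

Lemma edge_sum_compl (R : realFieldType) (T : finType) (E : rel T) (A : {set T}) :
  symmetric E -> {in A &, forall y z, ~~ E y z} ->
  edge_sum E A (~: A) = \sum_(x in A) #|nbhd E x|%:R :> R.
Proof.
move=> sE iA; rewrite -edge_sum_setT -(setUCr A) edge_sumUr ?disjoints_subset ?setCK //.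
by rewrite edge_sum_indep // add0r.
Qed.

Lemma edge_sum_setTT (R : realFieldType) (T : finType) (E : rel T) (A : {set T}) :
  symmetric E -> {in A &, forall y z, ~~ E y z} ->
  edge_sum E [set: T] [set: T] = 2 * edge_sum E A (~: A) + edge_sum E (~: A) (~: A) :> R.
Proof.
move=> sE iA; rewrite -(setUCr A) edge_sumU ?disjoints_subset ?setCK //.
by rewrite edge_sum_indep // add0r.
Qed.

Lemma sum_nbhd_nbhd (R : realFieldType) (T : finType) (E : rel T) (g : T -> R) :
  symmetric E ->
  \sum_x \sum_(y in nbhd E x) g y = \sum_y #|nbhd E y|%:R * g y.
Proof.
move=> sE; rewrite (exchange_big_dep xpredT) //=; apply: eq_bigr => y _.
rewrite sumr_const mulr_natl; congr (_ *+ _).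
by apply: eq_card => x; transitivity (y \in nbhd E x) => //; rewrite !inE sE.
Qed.

(** The edges leaving each neighbourhood sum to the squared degrees, and each such count is at most
    [W / 2] because neighbourhoods are independent. Cauchy-Schwarz finishes. *)
Lemma mantel (R : realFieldType) (T : finType) (E : rel T) :
  symmetric E -> triangle_free E ->
  edge_sum E [set: T] [set: T] <= #|T|%:R ^+ 2 / 2 :> R.
Proof.
move=> sE tfE; set W := edge_sum _ _ _; set n : R := #|T|%:R.
have WE : W = \sum_x #|nbhd E x|%:R.
  by rewrite /W edge_sum_setT; apply: eq_bigl => x; rewrite inE.
have sq_le : \sum_x #|nbhd E x|%:R ^+ 2 <= n * (W / 2).
  rewrite (eq_bigr (fun x => #|nbhd E x|%:R * #|nbhd E x|%:R)) //.
  rewrite -sum_nbhd_nbhd // mulr_natl -sumr_const; apply: ler_sum => x _.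
  have iN := nbhd_indep T E x sE tfE.
  rewrite -edge_sum_compl // /W (edge_sum_setTT R T E _ sE iN).
  have := edge_sum_ge0 R T E (~: nbhd E x) (~: nbhd E x); lra.
have : 0 <= \sum_x (n * #|nbhd E x|%:R - W) ^+ 2.
  by apply: sumr_ge0 => x _; apply: sqr_ge0.
rewrite (eq_bigr (fun x => n ^+ 2 * #|nbhd E x|%:R ^+ 2
   + (- 2 * n * W) * #|nbhd E x|%:R + W ^+ 2)); last by move=> x _; ring.
rewrite !big_split /= sumr_const -[W ^+ 2 *+ _]mulr_natl -!mulr_sumr -WE -/n => h.
have n0 : 0 <= n by rewrite ler0n.
have W0 : 0 <= W by apply: edge_sum_ge0.
rewrite leNgt; apply/negP => hW.
have Wp : 0 < W by apply: le_lt_trans hW; rewrite divr_ge0 ?exprn_ge0.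
have np : 0 < n.
  rewrite lt_neqAle n0 andbT; apply: contraTneq Wp => n00.
  rewrite -leNgt WE big1 // => x _; have := max_card (mem [set x]).
  by rewrite cards1 -(ler_nat R) -/n -n00 ler10.
have : n ^+ 2 * \sum_x #|nbhd E x|%:R ^+ 2 <= n ^+ 2 * (n * (W / 2)).
  by rewrite ler_wpM2l // exprn_ge0.
have : 0 < n * W * (W - n ^+ 2 / 2) by rewrite !mulr_gt0 // subr_gt0.
lra.
Qed.

(** * Existence of a suitable third *)

(** The constants are doubled because [edge_sum] counts ordered pairs; [2 n] absorbs the loss of
    [balanced_split]. *)
Definition good_third (R : realFieldType) (T : finType) (E : rel T) (m : nat) (A : {set T}) : Prop :=
  [/\ #|A| = m, edge_sum E A A <= #|T|%:R ^+ 2 / 24 :> R &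
    edge_sum E (~: A) (~: A) <= #|T|%:R ^+ 2 / 6 + 2 * #|T|%:R :> R].

Lemma good_third_sparse (R : realFieldType) (T : finType) (E : rel T) (m : nat) :
  symmetric E -> irreflexive E -> #|T| = (3 * m)%N ->
  edge_sum E [set: T] [set: T] <= 3/8 * #|T|%:R ^+ 2 :> R ->
  exists A, good_third R T E m A.
Proof.
move=> sE iE cT hW.
have [|A [_ cA wA wA']] := balanced_split R T E [set: T] 3 m sE iE isT; first by rewrite cardsT.
(* [1/9] and [4/9] of [3/8 n^2] are exactly [n^2/24] and [n^2/6]. *)
exists A; split=> //; first lra.
by move: wA'; rewrite setTD cardsT; lra.
Qed.

Lemma good_third_matching (R : realFieldType) (T : finType) (E : rel T) (m : nat) x :
  symmetric E -> irreflexive E -> triangle_free E -> #|T| = (3 * m)%N ->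
  3/8 * #|T|%:R ^+ 2 < edge_sum E [set: T] [set: T] :> R ->
  (2 * m <= #|nbhd E x|)%N -> exists A, good_third R T E m A.
Proof.
move=> sE iE tfE cT; set I := nbhd E x; set n : R := #|T|%:R => hW mI.
have indI := nbhd_indep T E x sE tfE.
have nE : n = 3 * m%:R by rewrite /n cT natrM.
have T0 : [set: T] != set0.
  apply: contraTneq hW => T0.
  by rewrite -leNgt T0 /edge_sum big_set0 mulr_ge0 ?divr_ge0 ?exprn_ge0.
have n0 : 0 < n by rewrite ltr0n -cardsT card_gt0.
have cIC : #|~: I|%:R = n - #|I|%:R :> R.
  by apply/eqP; rewrite eq_sym subr_eq /n -natrD addnC cardsC.
(* With [|I| - 2m] vertices in [Z], the third has size [m] and its complement [I \ Z] is
   independent. *)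
have [|Z [ZI cZ wZ]] := sparse_extension R T E I (#|I| - 2 * m) sE iE indI; first exact: leq_subr.
have dZ : [disjoint Z & ~: I] by rewrite disjoints_subset setCK.
exists (Z :|: ~: I); split.
- rewrite cardsU (disjoint_setI0 dZ) cards0 subn0 cZ.
  by have := cardsC I; rewrite cT; lia.
- apply: le_trans wZ _; rewrite -/n natrB // natrM.
  have -> : 2 * m%:R = 2/3 * n by rewrite nE; field.
  (* Adjacent vertices have no common neighbour in [I], so their degrees into [I] sum to at most
     [|I|]. *)
  have [| |nu [nu0 nuI fI eI]] := matching_bound R T E (fun u => \sum_(y in I) (E u y)%:R)
      #|I|%:R sE iE tfE (~: I).
  + by move=> u _; rewrite sum_edge ler_nat subset_leq_card // subsetIl.
  + move=> u v _ _ uv; rewrite -big_split /= -sum1_card natr_sum; apply: ler_sum => y _.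
    rewrite -natrD ler_nat; have := tfE u v y; rewrite uv /=.
    by case: (E u y); case: (E v y).
  move: fI eI; rewrite -/(edge_sum E (~: I) I) (edge_sumC _ _ _ (~: I)) // cIC => fI eI.
  set e := edge_sum E (~: I) (~: I) in eI hW *.
  have -> : e = 2 * (e / 2) by field.
  apply: (@matching_case_bound R n #|I|%:R _ _ nu) => //.
  + by rewrite nE mulrCA ler_pM2l // -natrM ler_nat.
  + by move: nuI; rewrite cIC; lra.
  + by move: hW; rewrite (edge_sum_setTT R T E I) // -/e; lra.
  + lra.
- rewrite setCU setCK edge_sum_indep.
    have := exprn_ge0 2 (ltW n0); rewrite -/n; lra.
  by move=> y z; rewrite !inE => /andP[_ yI] /andP[_ zI]; apply: indI; rewrite inE.
Qed.

Lemma good_third_dense (R : realFieldType) (T : finType) (E : rel T) (m : nat) :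
  symmetric E -> irreflexive E -> triangle_free E -> #|T| = (3 * m)%N ->
  3/8 * #|T|%:R ^+ 2 < edge_sum E [set: T] [set: T] :> R ->
  (forall x, #|nbhd E x| < 2 * m)%N -> exists A, good_third R T E m A.
Proof.
move=> sE iE tfE cT; set n : R := #|T|%:R => hW Nm.
have nE : n = 3 * m%:R by rewrite /n cT natrM.
have T0 : [set: T] != set0.
  apply: contraTneq hW => T0.
  by rewrite -leNgt T0 /edge_sum big_set0 mulr_ge0 ?divr_ge0 ?exprn_ge0.
have n0 : 0 < n by rewrite ltr0n -cardsT card_gt0.
have n2 : 0 < n ^+ 2 by rewrite exprn_gt0.
set W := edge_sum _ _ _ in hW.
have [al WE] : exists al, W = 2 * al * n ^+ 2.
  by exists (W / 2 / n ^+ 2); field; rewrite gt_eqF.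
have al1 : 3/16 <= al by rewrite -(ler_pM2r n2); lra.
have al2 : al <= 1/4.
  by rewrite -(ler_pM2r n2); have := mantel R T E sE tfE; rewrite -/W -/n; lra.
pose S x : R := edge_sum E (nbhd E x) (~: nbhd E x).
pose d x : R := #|nbhd E x|%:R.
(* [S] and [d^2] have equal sums and [d] sums to [2 al n^2], so the difference of the two sides has
   mean zero. *)
have [x hS] : exists x, d x ^+ 2 + slope al * (2 * al * n - d x) * n <= S x.
  have [x _] := @exists_le_average R T [set: T]
    (fun x => d x ^+ 2 + slope al * n * (2 * al * n - d x) - S x) T0.
  have -> : \sum_(y in [set: T]) (d y ^+ 2 + slope al * n * (2 * al * n - d y) - S y) = 0.
    rewrite (eq_bigl xpredT); last by move=> y; rewrite inE.
    rewrite !big_split /= sumrN -mulr_sumr big_split /= sumr_const sumrN.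
    have -> : \sum_y d y = W.
      by rewrite /W edge_sum_setT; apply: eq_bigl => y; rewrite inE.
    have -> : \sum_y S y = \sum_y d y ^+ 2.
      rewrite (eq_bigr (fun y => \sum_(z in nbhd E y) d z)).
        by rewrite sum_nbhd_nbhd.
      by move=> y _; rewrite /S edge_sum_compl //; apply: nbhd_indep.
    by rewrite -[_ *+ _]mulr_natl -/n WE; ring.
  rewrite cardsT -/n pmulr_rle0 // => h; exists x; lra.
have indN := nbhd_indep T E x sE tfE.
have W2 : W = 2 * S x + edge_sum E (~: nbhd E x) (~: nbhd E x) by apply: edge_sum_setTT.
have S0 : 0 <= S x by apply: edge_sum_ge0.
move: hS W2 S0; rewrite {}/d /S; have := Nm x; move: indN; set N := nbhd E x.
set s := edge_sum E N _; move=> indN NM hS W2 S0.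
have sN : s <= 2/3 * n * #|N|%:R.
  rewrite /s edge_sum_compl // [leRHS]mulrC [leRHS]mulr_natl -sumr_const; apply: ler_sum => y _.
  by have := ltnW (Nm y); rewrite -(ler_nat R) natrM nE; lra.
have cNC : #|~: N|%:R = n - #|N|%:R :> R.
  by apply/eqP; rewrite eq_sym subr_eq /n -natrD addnC cardsC.
have [mN|Nm'] := leqP m #|N|.
(* The third is the independent set [N \ Z]; [Z] joins the complement with at most its share of the
   edges leaving [N]. *)
- have [|Z [ZN cZ wZ]] := sparse_extension R T E N (#|N| - m) sE iE indN; first exact: leq_subr.
  exists (N :\: Z); split.
  + by rewrite cardsDS // cZ subKn.
  + rewrite edge_sum_indep; first by rewrite divr_ge0 // ltW.
    by move=> y z /setDP[yN _] /setDP[zN _]; apply: indN.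
  have -> : ~: (N :\: Z) = Z :|: ~: N by rewrite setCD setUC.
  apply: le_trans wZ _; rewrite natrB // -/s -/n.
  have m0 : 0 < m%:R :> R by lra.
  have N0 : 0 < #|N|%:R :> R by apply: lt_le_trans m0 _; rewrite ler_nat.
  have := large_degree_bound _ _ _ _ _ n0 al1 al2 hS.
  rewrite mulrC -ler_pdivlMl // => h.
  have -> : (#|N|%:R - m%:R) / #|N|%:R * s = s - m%:R * (#|N|%:R^-1 * s).
    by field; rewrite gt_eqF.
  have := ler_wpM2l (ltW m0) h.
  move: W2; rewrite WE nE; lra.
(* The cost is doubled because edges between [Z] and [N] count in both orders. *)
have [|Z [ZN cZ wZ]] := sparse_subset R T E (m - #|N|) sE iE (~: N)
  (fun y => 2 * \sum_(z in N) (E y z)%:R).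
  by have := cardsC N; rewrite cT; lia.
have dZ : [disjoint N & Z] by rewrite disjoint_sym disjoints_subset.
exists (N :|: Z); split.
- by rewrite cardsU (disjoint_setI0 dZ) cards0 subn0 cZ subnKC // ltnW.
- rewrite edge_sumU // edge_sum_indep // add0r -/n.
  move: wZ; rewrite -!mulr_sumr -/(edge_sum E Z N) -/(edge_sum E (~: N) N).
  rewrite (edge_sumC _ _ _ Z) // (edge_sumC _ _ _ (~: N) N) // -/s => wZ.
  rewrite [leLHS]addrC; apply: le_trans wZ _; rewrite cNC natrB ?(ltnW Nm') //.
  have -> : m%:R = n / 3 by rewrite nE; field.
  have -> : edge_sum E (~: N) (~: N) = 2 * al * n ^+ 2 - 2 * s by rewrite -WE W2; ring.
  apply: small_degree_bound_in => //.
  by move: (ltnW Nm'); rewrite -(ler_nat R) nE; lra.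
apply: le_trans (_ : edge_sum E (~: N) (~: N) <= _).
  by apply: edge_sumS; rewrite setCS subsetUl.
have := small_degree_bound_out _ _ _ _ _ n0 al1 al2 hS.
move: W2; rewrite WE; lra.
Qed.

Lemma exists_good_third (R : realFieldType) (T : finType) (E : rel T) (m : nat) :
  symmetric E -> irreflexive E -> triangle_free E -> #|T| = (3 * m)%N ->
  exists A, good_third R T E m A.
Proof.
move=> sE iE tfE cT.
have [hW|hW] := leP (edge_sum E [set: T] [set: T]) (3/8 * #|T|%:R ^+ 2 : R).
  exact: good_third_sparse.
have [/existsP[x hx]|/existsPn h] := boolP [exists x, (2 * m <= #|nbhd E x|)%N].
  exact: good_third_matching hx.
by apply: good_third_dense => // x; rewrite ltnNge.
Qed.

(** * Assembling the partition and the error term *)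

Lemma sparse_tripartition (R : realFieldType) (T : finType) (E : rel T) :
  symmetric E -> irreflexive E -> triangle_free E -> (3 %| #|T|)%N ->
  exists A : 'I_3 -> {set T},
    [/\ is_partition A, forall i, #|A i| = (#|T| %/ 3)%N &
        forall i, (num_edges_in E (A i))%:R <= #|T|%:R ^+ 2 / 48%:R + #|T|%:R :> R].
Proof.
move=> sE iE tfE /dvdnP[m]; rewrite mulnC => cT.
have [A1 [cA1 wA1 wA1']] := exists_good_third R T E m sE iE tfE cT.
have cA1' : #|~: A1| = (2 * m)%N by have := cardsC A1; lia.
have [A2 [sA2 cA2 wA2 wA3]] := balanced_split R T E (~: A1) 2 m sE iE isT cA1'.
exists (fun i : 'I_3 => nth set0 [:: A1; A2; ~: A1 :\: A2] i).
have i4 : 2%:R ^- 2 = 1/4 :> R by field.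
have j4 : (1 - 2%:R^-1) ^+ 2 = 1/4 :> R by field.
rewrite i4 j4 in wA2 wA3.
have n0 : 0 <= #|T|%:R :> R by [].
have nT : 3 * #|~: A1|%:R = 2 * #|T|%:R :> R by rewrite -!natrM cA1' cT mulnCA.
split.
- split.
    rewrite !big_ord_recl big_ord0 /= setU0 -{1}(setIidPr sA2) setID setUCr.
    by [].
  have d12 : [disjoint A1 & A2] by rewrite disjoint_sym disjoints_subset.
  have d13 : [disjoint A1 & ~: A1 :\: A2].
    by rewrite disjoint_sym disjoints_subset subsetDl.
  have d23 : [disjoint A2 & ~: A1 :\: A2].
    by rewrite disjoint_sym disjoints_subset subDset setUCr subsetT.
  by case=> [[|[|[|?]]] ?]; case=> [[|[|[|?]]] ?] //= _; rewrite // disjoint_sym.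
- rewrite cT mulKn // => -[[|[|[|?]]] ?] //=.
  by rewrite cardsDS // cA2 cA1' mul2n -addnn addnK.
(* The third part has the largest error: [2n/4] from the first cut and [2 * 2n/3] from the halving,
   in total [11n/12] after division by 2. *)
- case=> [[|[|[|?]]] ?] //=; apply: le_trans (num_edges_in_le _ _ _ _ sE iE) _; lra.
Qed.

From mathcomp Require Import all_classical all_reals all_analysis.
Import numFieldNormedType.Exports.
Local Open Scope ring_scope.

Theorem theorem1p9 (R : realType) :
  exists g : nat -> R,
    (g n / n%:R ^+ 2 @[n --> \oo] --> (0 : R))%classic /\
    forall (T : finType) (E : rel T),
      symmetric E -> irreflexive E -> triangle_free E ->
      (3 %| #|T|)%N ->
      exists A : 'I_3 -> {set T},
        [/\ is_partition A,
            forall i : 'I_3, #|A i| = (#|T| %/ 3)%N &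
            forall i : 'I_3,
              (num_edges_in E (A i))%:R <= #|T|%:R ^+ 2 / 48%:R + g #|T|].
Proof.
exists (fun n => n%:R); split; last first.
  by move=> T E sE iE tfE; apply: sparse_tripartition.
(* Shifted by one, [n / n^2] is the harmonic sequence. *)
rewrite -cvg_shiftS; apply: cvg_trans (@cvg_harmonic R); apply: near_eq_cvg.
by apply: nearW => n /=; rewrite expr2 invfM mulrA divff ?mul1r ?pnatr_eq0.
Qed.
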